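(* Let $N$ be a finite non-empty set of players; for each $\nu\in N$ let $K_\nu\subset\mathbb{R}^{n_\nu}$, let $\mathbb{R}^n=\prod_{\nu\in N}\mathbb{R}^{n_\nu}$ and $K=\prod_{\nu\in N}K_\nu$, let $X_\nu:K\rightrightarrows\mathbb{R}^{n_\nu}$ be a set-valued map and let $\theta_\nu:\mathbb{R}^n\to\mathbb{R}$ be a function. Let $\|\cdot\|$ be any norm in $\mathbb{R}^n$. Assume that for each player $\nu\in N$: 1. $K_\nu$ is a convex, compact and non-empty subset of $\mathbb{R}^{n_\nu}$; 2. $X_\nu$ is continuous with convex, compact and non-empty values; 3. $\theta_\nu$ is pseudo-continuous; and 4. $\theta_\nu(\cdot,x^{-\nu})$ is quasi-convex, for all $x^{-\nu}$. Then there exists a projected solution, that is, there exist $\hat{x}\in K$ and $\hat{y}\in\prod_{\nu\in N}X_\nu(\hat{x})$ such that $\hat{x}\in P_K(\hat{y})$ and, for every $\nu\in N$, $\theta_\nu(\hat{y})\le\theta_\nu(w^\nu,\hat{y}^{-\nu})$ for all $w^\nu\in X_\nu(\hat{x})$.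
   Context: Notation: a vector $x\in\mathbb{R}^n=\prod_{\nu\in N}\mathbb{R}^{n_\nu}$ is written $x=(x^\nu,x^{-\nu})$, where $x^\nu\in\mathbb{R}^{n_\nu}$ is the component of player $\nu$ and $x^{-\nu}\in\prod_{\mu\in N\setminus\{\nu\}}\mathbb{R}^{n_\mu}$ collects the components of the other players. Projection: for $A\subset\mathbb{R}^n$ and $z\in\mathbb{R}^n$, $P_A(z)=\{w\in A:\ \|z-w\|\le\|z-x\|\text{ for all }x\in A\}$, with respect to the given norm; it may be multivalued. ''$\hat{x}$ is a projection of $\hat{y}$ onto $K$'' means $\hat{x}\in P_K(\hat{y})$. Set-valued maps: a set-valued map $T:X\rightrightarrows Y$ between topological spaces is lower semicontinuous at $x$ if for each open $V\subset Y$ with $T(x)\cap V\ne\emptyset$ there is a neighbourhood $\mathscr{V}_x$ of $x$ with $T(x')\cap V\ne\emptyset$ for every $x'\in\mathscr{V}_x$; it is upper semicontinuous at $x$ if for each open $V\subset Y$ with $T(x)\subset V$ there is a neighbourhood $\mathscr{V}_x$ of $x$ with $T(x')\subset V$ for every $x'\in\mathscr{V}_x$. $T$ is continuous if it is both upper and lower semicontinuous (at every point). Pseudo-continuity: a function $f:X\to\mathbb{R}$ on a topological space is upper pseudo-continuous if for any $x,y\in X$ with $f(x)<f(y)$ there is a neighbourhood $\mathscr{V}_x$ of $x$ such that $f(x')<f(y)$ for all $x'\in\mathscr{V}_x$; it is lower pseudo-continuous if $-f$ is upper pseudo-continuous; it is pseudo-continuous if it is both. *)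

(* Defs.v *)
From HB Require Import structures.
From mathcomp Require Import all_boot all_order all_algebra.
From mathcomp Require Import all_classical all_reals all_analysis.

Set Implicit Arguments.
Unset Strict Implicit.
Unset Printing Implicit Defensive.

Import Order.TTheory GRing.Theory Num.Theory.
Import numFieldNormedType.Exports.

Local Open Scope classical_set_scope.
Local Open Scope convex_scope.
Local Open Scope ring_scope.

(* The space R^n = \prod_(nu in N) R^(n_nu), with its product topology. *)
Definition player_space (R : realType) (N : finType) (n : N -> nat) :=
  prod_topology (fun nu : N => 'rV[R]_(n nu)).

Definition set_prod (R : realType) (N : finType) (n : N -> nat)
    (A : forall nu : N, set 'rV[R]_(n nu)) : set (player_space R n) :=
  [set x | forall nu, A nu (x nu)].

(* Dependent functions carry no lmodType structure in the library, so the
   vector operations are written componentwise. Nonnegativity and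
   [nrm 0 = 0] are consequences of these axioms. *)
Definition is_norm (R : realType) (N : finType) (n : N -> nat)
    (nrm : player_space R n -> R) :=
  [/\ forall x y : player_space R n,
        nrm (fun nu => x nu + y nu) <= nrm x + nrm y,
      forall (a : R) (x : player_space R n),
        nrm (fun nu => a *: x nu) = `|a| * nrm x
    & forall x : player_space R n, nrm x = 0 -> forall nu, x nu = 0].

Definition metric_projection (R : realType) (N : finType) (n : N -> nat)
    (nrm : player_space R n -> R) (A : set (player_space R n))
    (z : player_space R n) : set (player_space R n) :=
  [set w | A w /\
    forall x, A x -> nrm (fun nu => z nu - w nu) <= nrm (fun nu => z nu - x nu)].

Definition lsc_map_at (X Y : topologicalType) (T : X -> set Y) (x : X) :=
  forall V : set Y, open V -> T x `&` V !=set0 ->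
    \forall x' \near x, T x' `&` V !=set0.

Definition usc_map_at (X Y : topologicalType) (T : X -> set Y) (x : X) :=
  forall V : set Y, open V -> T x `<=` V -> \forall x' \near x, T x' `<=` V.

(* Continuity of the set-valued map T : A => Y, for the topology induced on A;
   the values of T outside A are irrelevant. *)
Definition continuous_map_on (X Y : topologicalType) (A : set X)
    (T : X -> set Y) :=
  forall x, A x ->
    lsc_map_at (T : subspace A -> set Y) x /\
    usc_map_at (T : subspace A -> set Y) x.

Definition upper_pseudo_continuous (R : realType) (X : topologicalType)
    (f : X -> R) :=
  forall x y : X, f x < f y -> \forall x' \near x, f x' < f y.

Definition lower_pseudo_continuous (R : realType) (X : topologicalType)
    (f : X -> R) :=
  upper_pseudo_continuous (fun x => - f x).

Definition pseudo_continuous (R : realType) (X : topologicalType)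
    (f : X -> R) :=
  upper_pseudo_continuous f /\ lower_pseudo_continuous f.

Definition quasi_convex (R : realType) (E : lmodType R)
    (E' := convex_lmodType E) (f : E' -> R) :=
  forall (t : {i01 R}) (x y : E'), f (x <| t |> y) <= Num.max (f x) (f y).

(* Main.v *)
(* The theorem is an instance of Kakutani's fixed point theorem, applied to the
   map (x, y) |-> P_K(y) * prod_nu argmin_{w in X_nu(x)} theta_nu(w, y^{-nu}) on
   the product of K with a large box. Pseudo-continuity is what makes
   {(p, q) | f p < f q} open, hence the argmin map closed.

   Kakutani's theorem is proved without triangulations. Scarf's lemma on finite
   families of total orders, a parity argument, gives on the grid points of a
   simplex a cluster of points that carries enough labels; by compactness,
   closed sets G_i covering the simplex, with G_i containing the face t_i = 0,
   have a common point. Given an e-net x_i of a convex compact set C and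
   z_i in F(x_i), the sets
   G_i = {t | t_i * sum_j g_j(t) <= g_i(t)}, with
   g_i(t) = max(0, e - |x_i - sum_j t_j z_j|),
   then yield a convex combination x of values of F at points e-close to x, and
   one lets e tend to 0. *)

From HB Require Import structures.
From mathcomp Require Import all_boot zify.

Set Implicit Arguments.
Unset Strict Implicit.
Unset Printing Implicit Defensive.

(** * Scarf's lemma *)

Lemma card_imset_drop (A B : finType) (f : A -> B) (S : {set A}) :
  #|S| = #|f @: S|.+1 ->
  #|[set a in S | f @: (S :\ a) == f @: S]| = 2.
Proof.
move=> cS.
have /dinjectivePn[a aS [b /andP[ba bS] fab]] : ~~ dinjectiveb f (mem S).
  apply/negP => /dinjectiveP /card_in_imset h; move: cS; rewrite h.
  by move/esym/eqP; rewrite eqn_leq ltnn.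
rewrite (_ : [set _ in _ | _] = [set a; b]); first by rewrite cards2 eq_sym ba.
have drop x y : x \in S -> y \in S -> y != x -> f x = f y ->
    f @: (S :\ x) = f @: S.
  move=> xS yS yx fxy; apply/eqP; rewrite eqEsubset imsetS ?subsetDl //=.
  apply/subsetP => _ /imsetP[z zS ->]; have [->|zx] := eqVneq z x.
    by rewrite fxy imset_f // !inE yx.
  by rewrite imset_f // !inE zx.
apply/setP => k; rewrite !inE; apply/andP/orP => [[kS /eqP fk]|]; last first.
  by case=> /eqP->; split=> //; apply/eqP;
    [exact: (drop a b)|apply: (drop b a); rewrite // eq_sym].
have inj : {in S :\ k &, injective f}.
  apply/imset_injP; rewrite fk; move: cS.
  by rewrite (cardsD1 k S) kS add1n => -[->].
have [->|ka] := eqVneq k a; [by left|right].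
apply: contraT => kb; suff ab : a = b by rewrite ab eqxx in ba.
by apply: inj => //; rewrite !inE eq_sym ?ka ?kb.
Qed.

(* The elements [s i] are slack vertices: [s i] is the bottom of the order [i]
   and lies above all ordinary vertices in the other orders. A pair of a set of
   vertices and a set C of indices is thereby encoded as one subset of [W],
   which contains [s i] exactly when [i] is not in C. *)
Section Scarf.
Variables (W I : finType) (r : I -> W -> nat) (s : I -> W) (c : W -> I).
Variable i0 : I.
Hypothesis r_inj : forall i, injective (r i).
Hypothesis cs : cancel s c.
Hypothesis r_bot : forall i w, r i (s i) <= r i w.
Hypothesis r_top : forall i k w, i != k -> w \notin codom s ->
  r i w < r i (s k).

(** Scarf's dominating sets, stated positively: no [v] lies, in each order at once, strictly above
    some element of [S]. *)
Definition dominant (S : {set W}) : bool :=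
  [forall v, exists i, [forall x in S, r i v <= r i x]].

Let lowest (T : {set W}) i v : bool := [forall x in T, r i v <= r i x].

Let lowestPn (T : {set W}) i v :
  reflect (exists2 y, y \in T & r i y < r i v) (~~ lowest T i v).
Proof.
apply: (iffP forall_inPn) => -[y yT h]; exists y => //; first by rewrite ltnNge.
by rewrite -ltnNge.
Qed.

Let dominantP (S : {set W}) : reflect (forall v, exists i, lowest S i v) (dominant S).
Proof. by apply: (iffP forallP) => h v; apply/existsP/h. Qed.

Let dominantS (S T : {set W}) : T \subset S -> dominant S -> dominant T.
Proof.
move=> TS /dominantP dS; apply/dominantP => v; have [i /forall_inP h] := dS v.
by exists i; apply/forall_inP => x xT; apply/h/(subsetP TS).
Qed.

(* the candidates for completing the door T to a room, in direction i *)
Let M (T : {set W}) i := [set v | [forall l, (l != i) ==> ~~ lowest T l v]].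

Let inM T i v : v \in M T i -> forall l, lowest T l v -> l = i.
Proof.
rewrite inE => /forallP h l lv; have := h l; rewrite lv implybF negbK.
by move/eqP.
Qed.

Let notinM T i v : v \notin M T i -> exists2 l, l != i & lowest T l v.
Proof.
by rewrite inE => /forallPn[l]; rewrite negb_imply negbK => /andP[]; exists l.
Qed.

Let top (T : {set W}) i x := (x \in M T i) && [forall v in M T i, r i v <= r i x].

Let top_uniq T i x y : top T i x -> top T i y -> x = y.
Proof.
move=> /andP[xM /forall_inP hx] /andP[yM /forall_inP hy].
by apply: (@r_inj i); apply/eqP; rewrite eqn_leq hx ?hy.
Qed.

Let ex_top T i v : v \in M T i -> exists x, top T i x.
Proof.
move=> vM; case: (arg_maxnP (r i) vM) => x xM h.
by exists x; apply/andP; split=> //; apply/forall_inP.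
Qed.

Let lowest_top T i x l : dominant T -> top T i x -> lowest T l x = (l == i).
Proof.
move=> /dominantP dT /andP[xM _]; apply/idP/eqP => [|->]; first exact: inM.
by have [k kx] := dT x; rewrite -(inM xM kx).
Qed.

(** A candidate [v] stays lowest in order [i] because [x] is the highest candidate. Any other [v] is
    lowest for [T] in some order [l != i], where [x] lies above an element of [T] and hence above
    [v]. *)
Let dominant_top T i x : dominant T -> top T i x -> dominant (x |: T).
Proof.
move=> /[dup] dT0 /dominantP dT /andP[xM /forall_inP xmax].
apply/dominantP => v.
have [vM|/notinM[l li lv]] := boolP (v \in M T i).
  exists i; have [k kv] := dT v; have ki := inM vM kv; rewrite {}ki in kv.
  apply/forall_inP => y /setU1P[->|]; first exact: xmax.
  by move: y; apply/forall_inP.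
exists l; apply/forall_inP => y /setU1P[->|]; last by move: y; apply/forall_inP.
have /lowestPn[z zT zx] : ~~ lowest T l x.
  by apply: contra li => lx; rewrite (inM xM lx).
by apply: leq_trans (ltnW zx); move/forall_inP: lv; apply.
Qed.

(** Converse of [dominant_top]. By dominance, sending an order to the minimum of [S] in it is onto
    [S]; as [#|S| = #|I|] it is a bijection, so [x] is the minimum in a single order [i]. *)
Let top_dominant (T : {set W}) x : x \notin T -> #|T|.+1 = #|I| ->
    dominant (x |: T) ->
  exists i, top T i x.
Proof.
move=> xT cT dS; set S := x |: T in dS.
have cS : #|S| = #|I| by rewrite cardsU1 xT.
have xS : x \in S by rewrite setU11.
pose mu i := [arg min_(t < x | t \in S) r i t].
have muP i y : y \in S -> lowest S i y -> mu i = y.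
  rewrite /mu => yS /forall_inP yl; case: arg_minnP => // z zS zmin.
  by apply: (@r_inj i); apply/eqP; rewrite eqn_leq zmin ?yl.
have mulow i : lowest S i (mu i).
  by rewrite /mu; case: arg_minnP => // z zS zmin; apply/forall_inP.
have muS : mu @: [set: I] = S.
  apply/eqP; rewrite eqEsubset; apply/andP; split.
    apply/subsetP => _ /imsetP[i _ ->]; rewrite /mu.
    by case: arg_minnP.
  apply/subsetP => y yS; have /dominantP/(_ y)[i iy] := dS.
  by rewrite -(muP i y) // imset_f.
have /imset_injP mu_inj : #|mu @: [set: I]| == #|[set: I]|.
  by rewrite muS cS cardsT.
have lowT l : lowest T l x -> mu l = x.
  move=> /forall_inP h; apply: muP => //.
  by apply/forall_inP => y /setU1P[->//|]; exact: h.
have /dominantP/(_ x)[i ix] := dS.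
have muix := muP _ _ xS ix.
exists i; apply/andP; split.
  rewrite inE; apply/forallP => l; apply/implyP; apply: contra => lx.
  by apply/eqP/mu_inj; rewrite ?inE // muix lowT.
apply/forall_inP => v vM; have /dominantP/(_ v)[l lv] := dS.
suff <- : l = i by move/forall_inP: lv; apply.
apply: inM vM _ _; apply/forall_inP => y yT.
by move/forall_inP: lv; apply; rewrite inE yT orbT.
Qed.

(** A door carries each colour other than [i0] exactly once. A room has one more element, so it
    either is rainbow or repeats one colour. *)
Let door T := [&& dominant T, c @: T == ~: [set i0] & #|T|.+1 == #|I|].
Let room S := [&& dominant S, ~: [set i0] \subset c @: S & #|S| == #|I|].

Let ltnI : #|I| = #|~: [set i0]|.+1.
Proof. by have := cardsC [set i0]; rewrite cards1 add1n. Qed.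

Let doors_in (S : {set W}) : room S ->
  [set T | door T & T \subset S]
  = (fun x => S :\ x) @: [set x in S | c @: (S :\ x) == ~: [set i0]].
Proof.
case/and3P=> dS cS /eqP nS; apply/setP => T; rewrite inE; apply/andP/imsetP.
  move=> [/and3P[dT cT /eqP nT] TS].
  have : #|S :\: T| == 1 by rewrite cardsDS // nS -nT subSnn.
  move=> /cards1P[x Sx]; have : x \in S :\: T by rewrite Sx set11.
  rewrite inE => /andP[xT xS].
  have TE : T = S :\ x by rewrite -Sx setDDr setDv set0U; apply/esym/setIidPr.
  by exists x; rewrite // inE xS -TE.
move=> [x]; rewrite inE => /andP[xS cx] ->; split; last exact: subsetDl.
apply/and3P; split => //; first by apply: dominantS dS; exact: subsetDl.
by rewrite -nS (cardsD1 x S) xS.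
Qed.

Let card_doors_in (S : {set W}) : room S -> c @: S != setT ->
  #|[set T | door T & T \subset S]| = 2.
Proof.
move=> rS cST; rewrite doors_in //; case/and3P: rS => dS cS /eqP nS.
have cSE : c @: S = ~: [set i0].
  apply/eqP; rewrite eq_sym eqEcard cS /= -ltnS -ltnI -cardsT.
  by apply: proper_card; rewrite properT.
rewrite card_in_imset => [|x y]; rewrite -?cSE.
  by rewrite card_imset_drop // nS cSE.
rewrite !inE => /andP[xS _] /andP[yS _] /setP/(_ x).
by rewrite !inE eqxx xS /= andbT => /esym/negbFE/eqP.
Qed.

Let good (T : {set W}) i := (M T i != set0) && [disjoint T & M T i].

(** The rooms around [T] arise by adding the top candidate in a good direction. Distinct directions
    give distinct rooms, since the added vertex is lowest for [T] in its own direction only. *)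
Let card_rooms (T : {set W}) : door T ->
  #|[set S | room S & T \subset S]| = #|[set i | good T i]|.
Proof.
case/and3P=> dT /eqP cT /eqP nT.
pose g i := odflt (s i) [pick x | top T i x] |: T.
have gE i x : top T i x -> g i = x |: T.
  rewrite /g; case: pickP => [y yt xt /=|/(_ x)->//].
  by rewrite (top_uniq xt yt).
have good_top i : good T i -> exists2 x, top T i x & x \notin T.
  case/andP=> /set0Pn[v /ex_top[x xt]] dis; exists x => //.
  by apply/negP => xT; case/andP: xt; rewrite (disjointFr dis xT).
have -> : [set S | room S & T \subset S] = g @: [set i | good T i].
  apply/setP => S; rewrite inE; apply/andP/imsetP => [[rS TS]|[i]].
    case/and3P: rS => dS cS /eqP nS.
    have : #|S :\: T| == 1 by rewrite cardsDS // nS -nT subSnn.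
    move=> /cards1P[x Sx]; have : x \in S :\: T by rewrite Sx set11.
    rewrite inE => /andP[xT xS].
    have SE : S = x |: T by rewrite -[LHS](setID S T) Sx (setIidPr TS) setUC.
    rewrite SE in dS *; have [i xt] := top_dominant xT nT dS.
    exists i; last by rewrite (gE i x).
    rewrite inE; apply/andP; split.
      by apply/set0Pn; exists x; case/andP: xt.
    rewrite disjoints_subset; apply/subsetP => t tT; rewrite inE.
    apply: contra xT => tM; suff -> : x = t by [].
    have /dominantP/(_ t)[l /forall_inP lt] := dS.
    have li : l = i by apply: inM tM _ _; apply/forall_inP => y yT; exact/lt/setU1r.
    rewrite {}li in lt; apply: (@r_inj i); apply/eqP.
    rewrite eqn_leq lt ?setU11 // andbT.
    by have := lowest_top i dT xt; rewrite eqxx => /forall_inP; apply.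
  rewrite inE => /good_top[x xt xT] ->; rewrite (gE i x) //.
  split; last exact: subsetUr.
  apply/and3P; split; first exact: dominant_top xt.
    by rewrite -cT imsetS ?subsetUr.
  by rewrite cardsU1 xT add1n nT.
rewrite card_in_imset // => i j; rewrite !inE => /good_top[x xt xT] /good_top[y yt yT].
rewrite (gE _ _ xt) (gE _ _ yt) => /setP/(_ x); rewrite !inE eqxx (negPf xT) !orbF.
move=> /esym/eqP xy; rewrite -{y yT}xy in yt.
by have := lowest_top i dT yt; rewrite (lowest_top i dT xt) eqxx => /esym/eqP.
Qed.

Let s_inj : injective s. Proof. exact: can_inj cs. Qed.

Let r_bot_lt i k : k != i -> r i (s i) < r i (s k).
Proof.
move=> ki; rewrite ltn_neqAle r_bot andbT; apply: contra ki => /eqP.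
by move=> /r_inj/s_inj ->.
Qed.

Let T0 := s @: ~: [set i0].

Let lowest_slack T k : lowest T k (s k).
Proof. by apply/forall_inP => y _; exact: r_bot. Qed.

(** A candidate in a direction other than [i0] must lie above some [s k], [k != i0], in the order
    [i0]. Ordinary vertices and [s i0] do not, and the remaining slack vertices belong to [T0]. *)
Let card_rooms_T0 : door T0 -> #|[set S | room S & T0 \subset S]| = 1.
Proof.
move=> dT0; rewrite card_rooms // (_ : [set _ | _] = [set i0]) ?cards1 //.
apply/setP => i; rewrite !inE; apply/andP/eqP => [[/set0Pn[x xM] dis]|->].
  apply/eqP; apply: contraT => ii0.
  have xT : x \notin T0.
    by apply/negP => xT; rewrite (disjointFr dis xT) in xM.
  have /lowestPn[_ /imsetP[k ki0 ->] kx] : ~~ lowest T0 i0 x.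
    by apply: contraNN ii0 => lx; rewrite (inM xM lx).
  rewrite !inE in ki0.
  have [/codomP[m xE]|xs] := boolP (x \in codom s); last first.
    have /(ltn_trans kx) : r i0 x < r i0 (s k) by apply: r_top; rewrite // eq_sym.
    by rewrite ltnn.
  have [mi0|mi0] := eqVneq m i0.
    by move: kx; rewrite xE mi0 ltnNge r_bot.
  by rewrite xE imset_f ?inE in xT.
split.
  apply/set0Pn; exists (s i0); rewrite inE; apply/forallP => l; apply/implyP => li.
  by apply/lowestPn; exists (s l); rewrite ?imset_f ?inE // r_bot_lt // eq_sym.
rewrite disjoints_subset; apply/subsetP => _ /imsetP[k ki0 ->]; rewrite inE.
by apply/negP => /inM/(_ k (lowest_slack _ _)) kE; rewrite kE !inE eqxx in ki0.
Qed.

Let door_T0 : door T0.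
Proof.
apply/and3P; split; last by rewrite card_imset // -ltnI.
  apply/dominantP => v; have [/codomP[m ->]|vs] := boolP (v \in codom s).
    by exists m.
  exists i0; apply/forall_inP => _ /imsetP[k ki0 ->].
  by rewrite ltnW // r_top // eq_sym; rewrite !inE in ki0.
by rewrite /T0 -imset_comp (eq_imset _ (cs : c \o s =1 id)) imset_id.
Qed.

(** An ordinary vertex [y] of [T] makes [s i] a candidate in every direction [i]. A direction is
    then good exactly when the minima of [T] in the other orders still exhaust [T], and
    [card_imset_drop] counts two such directions. *)
Let card_rooms_door (T : {set W}) : door T -> T != T0 ->
  #|[set S | room S & T \subset S]| = 2.
Proof.
move=> dT TT0; rewrite card_rooms //; case/and3P: dT => dT /eqP cT /eqP nT.
have [y yT ys] : exists2 y, y \in T & y \notin codom s.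
  apply/exists_inP; apply: contraNT TT0 => /exists_inPn/= h.
  rewrite /T0 -cT -imset_comp; apply/eqP.
  rewrite -[LHS]imset_id; apply: eq_in_imset => x /h /negPn /codomP[k ->] /=.
  by rewrite cs.
pose mu i := [arg min_(t < y | t \in T) r i t].
have mulow i : mu i \in T /\ lowest T i (mu i).
  by rewrite /mu; case: arg_minnP => // z zT zmin; split => //; apply/forall_inP.
have muP i t : t \in T -> lowest T i t -> mu i = t.
  move=> tT /forall_inP tl; have [mT /forall_inP ml] := mulow i.
  by apply: (@r_inj i); apply/eqP; rewrite eqn_leq tl ?ml.
have muT : mu @: [set: I] = T.
  apply/eqP; rewrite eqEsubset; apply/andP; split.
    by apply/subsetP => _ /imsetP[i _ ->]; case: (mulow i).
  apply/subsetP => t tT; have /dominantP/(_ t)[i it] := dT.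
  by rewrite -(muP i t) // imset_f.
rewrite -(@card_imset_drop _ _ mu setT) ?muT ?cardsT //.
apply: eq_card => i; rewrite !inE setTD /=; apply/andP/eqP => [[_ dis]|muTi].
  apply/eqP; rewrite eqEsubset; apply/andP; split.
    by apply/subsetP => _ /imsetP[k _ ->]; case: (mulow k).
  apply/subsetP => t tT.
  have /notinM[l li lt] : t \notin M T i.
    by rewrite (disjointFr dis tT).
  by rewrite -(muP l t) // imset_f // !inE li.
split.
  apply/set0Pn; exists (s i); rewrite inE; apply/forallP => l; apply/implyP => li.
  by apply/lowestPn; exists y => //; exact: r_top.
rewrite disjoints_subset; apply/subsetP => t; rewrite -{1}muTi inE.
case/imsetP => l; rewrite in_setC1 => li ->.
by apply/negP => /inM/(_ l (mulow l).2) lE; rewrite lE eqxx in li.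
Qed.

(* Double counting of the pairs of a door and a room containing it: [T0] lies in
   one room and every other door in two, while a room missing a colour contains
   exactly two doors. *)
Lemma dominant_rainbow : exists S : {set W},
  dominant S /\ c @: S = setT.
Proof.
have [/existsP[S /andP[/and3P[dS _ _] /eqP cS]]|/existsPn h] :=
  boolP [exists S, room S && (c @: S == setT)]; first by exists S.
have : \sum_(S | room S) #|[set T | door T & T \subset S]| =
       \sum_(T | door T) #|[set S | room S & T \subset S]|.
  under eq_bigr => S _ do rewrite cardsE -sum1_card.
  under [RHS]eq_bigr => T _ do rewrite cardsE -sum1_card.
  rewrite (exchange_big_dep door) /=; last by move=> S T _ /andP[].
  by apply: eq_bigr => T dT; apply: eq_bigl => S; rewrite unfold_in /= dT.
under eq_bigr => S rS.
  rewrite card_doors_in //; last by have := h S; rewrite rS.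
  over.
rewrite (bigD1 T0 door_T0) (card_rooms_T0 door_T0).
under [X in _ = _ + X]eq_bigr => T /andP[dT TT0] do rewrite card_rooms_door //.
rewrite !sum_nat_const => /(congr1 odd).
by rewrite addnC addn1 /= !oddM !andbF.
Qed.
End Scarf.

(** The form of Scarf's lemma without slack vertices and with ties allowed: [C] collects the indices
    whose slack vertex is absent from the rainbow dominant set. *)
Lemma scarf (V I : finType) (ht : I -> V -> nat) (col : V -> I) (v0 : V) :
  exists (S : {set V}) (C : {set I}),
    [/\ S != set0,
        forall i, i \in C -> exists2 x, x \in S & col x = i
      & forall v, exists2 i, i \in C & forall x, x \in S -> ht i v <= ht i x].
Proof.
(* Ties of [ht i] are broken by the enumeration of [V]; strict inequalities survive. *)
pose rk i v := ht i v * #|V| + enum_rank v.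
have rk_lt i v w : ht i v < ht i w -> rk i v < rk i w.
  move=> vw; apply: leq_trans (leq_addr _ _).
  apply: (@leq_trans ((ht i v).+1 * #|V|)); last by rewrite leq_mul2r vw orbT.
  by rewrite mulSn /rk [X in X < _]addnC ltn_add2r ltn_ord.
have rk_inj i : injective (rk i).
  move=> v w e; apply/enum_rank_inj/val_inj => /=.
  suff hE : ht i v = ht i w by move: e; rewrite /rk hE => /addnI.
  by case: (ltngtP (ht i v) (ht i w)) => // /rk_lt; rewrite e ltnn.
(* Ordinary vertices are shifted up by one so that rank 0 is left for the slack vertex of the order;
   [B] exceeds all shifted ranks. *)
pose B := (\max_(p : I * V) rk p.1 p.2).+2.
have rkB i v : (rk i v).+1 < B by rewrite /B !ltnS (leq_bigmax (i, v)).
pose r i (w : V + I) := match w with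
  | inl v => (rk i v).+1
  | inr k => if k == i then 0 else B + enum_rank k
  end.
have r_inj i : injective (r i).
  move=> [v|k] [w|l] /=; first by case=> /rk_inj ->.
  - by case: eqP => // _ e; have := rkB i v; rewrite e; lia.
  - by case: eqP => // _ e; have := rkB i w; rewrite -e; lia.
  - case: eqP => [->|_]; case: eqP => [-> //|_] //; do ?by rewrite /B addSn.
    by move=> /addnI /val_inj /enum_rank_inj ->.
pose c (w : V + I) := match w with inl v => col v | inr k => k end.
have [||S [dS cS]] := @dominant_rainbow _ _ r inr c (col v0) r_inj (fun=> erefl).
- by move=> i w /=; rewrite eqxx.
- move=> i k [v|l] ik; last by rewrite codom_f.
  by move=> _ /=; rewrite eq_sym (negPf ik); have := rkB i v; lia.
exists [set v | inl v \in S], [set i | inr i \notin S].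
have dom v : exists2 i, inr i \notin S & forall x, inl x \in S -> ht i v <= ht i x.
  have /existsP[i /forall_inP h] := forallP dS (inl v).
  exists i; first by apply/negP => /h /=; rewrite eqxx.
  move=> x /h /=; rewrite ltnS leqNgt => xv; rewrite leqNgt.
  by apply: contra xv; exact: rk_lt.
split; last by move=> v; have [i iS h] := dom v;
  exists i => [|x]; rewrite inE // => /h.
  have [i iS _] := dom v0; have := in_setT i; rewrite -cS => /imsetP[[x|k] xS ic].
    by apply/set0Pn; exists x; rewrite inE.
  by move: iS; rewrite ic /= xS.
move=> i; rewrite inE => iS; have := in_setT i; rewrite -cS => /imsetP[[x|k] xS ic].
  by exists x; rewrite ?inE.
by move: iS; rewrite ic /= xS.
Qed.

(** Scarf's lemma with the coordinates as heights. Dominance forces the coordinates of the points of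
    [S] into windows of width [n], independently of [m]; the coordinates outside [C] are small. *)
Lemma grid_rainbow n m (i0 : 'I_n) (col : {ffun 'I_n -> 'I_m.+1} -> 'I_n) :
  exists2 x : {ffun 'I_n -> 'I_m.+1}, \sum_i x i = m &
    forall i, x i <= n \/
      exists y : {ffun 'I_n -> 'I_m.+1}, [/\ \sum_i y i = m, col y = i
        & forall k, x k <= y k + n /\ y k <= x k + n].
Proof.
pose V := {x : {ffun 'I_n -> 'I_m.+1} | \sum_i x i == m}.
have mkV (f : 'I_n -> nat) : \sum_i f i = m ->
    exists v : V, forall i, val v i = f i :> nat.
  move=> fm; have fle i : f i < m.+1 by rewrite ltnS -fm (bigD1 i) //= leq_addr.
  pose g : {ffun 'I_n -> 'I_m.+1} := [ffun i => Ordinal (fle i)].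
  have gE : \sum_i g i == m.
    by apply/eqP; rewrite -[RHS]fm; apply: eq_bigr => i _; rewrite ffunE.
  by exists (exist _ g gE) => i; rewrite /= ffunE.
have [v0 _] : exists v : V, forall i, val v i = (if i == i0 then m else 0) :> nat.
  by apply: mkV; rewrite -big_mkcond big_pred1_eq.
have [S [C [/set0Pn[x0 x0S] colC dom]]] :=
  scarf (fun i (v : V) => val v i : nat) (fun v => col (val v)) v0.
pose mu i := val [arg min_(x < x0 | x \in S) val x i] i : nat.
have mu_le i x : x \in S -> mu i <= val x i.
  by move=> xS; rewrite /mu; case: arg_minnP => // y yS; apply.
have mu_att i : exists2 x, x \in S & val x i = mu i :> nat.
  by rewrite /mu; case: arg_minnP => // y yS _; exists y.
(* Otherwise all minima over [C] can be raised by one at total cost at most [m]. Giving the surplus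
   [m - D] to the coordinate [i1] yields a grid point strictly above the minima in every order of
   [C], against [dom]. *)
have mC : m < \sum_(i in C) mu i + n.
  rewrite ltnNge; apply/negP => big.
  have big' : \sum_(i in C) (mu i).+1 <= m.
    apply: leq_trans big; under eq_bigr do rewrite -addn1.
    by rewrite big_split /= leq_add2l sum1_card -[X in _ <= X]card_ord max_card.
  have [i1 i1C _] := dom v0.
  set D := \sum_(i in C) (mu i).+1 in big'.
  have [v vE] : exists v : V, forall i, val v i =
      (if i \in C then (mu i).+1 + (i == i1) * (m - D) else 0) :> nat.
    apply: mkV; rewrite -big_mkcond big_split /= -/D -big_distrl /=.
    rewrite (bigD1 i1) //= eqxx big1 ?addn0 ?mul1n ?subnKC //.
    by move=> i /andP[_ /negPf ->].
  have [i iC h] := dom v; have [x xS xi] := mu_att i.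
  by have := h x xS; rewrite /= vE iC xi; lia.
(* The minima over [C] nearly use up the total [m], so less than [n] is left for any excess in [C]
   or any coordinate outside it. *)
have arith a b X Y : Y <= X -> m < b + Y + n -> a + X <= m -> a < b + n by lia.
have sumC (x : V) : \sum_(i in C) val x i <= m.
  by rewrite -[X in _ <= X](eqP (valP x)) big_mkcond leq_sum // => i _; case: ifP.
have bndC (x : V) i : x \in S -> i \in C -> val x i < mu i + n.
  move=> xS iC; have := sumC x; rewrite (bigD1 i) //=; apply: arith.
    by apply: leq_sum => k _; apply: (mu_le k x xS).
  by have := mC; rewrite (bigD1 i).
have bndNC (x : V) i : x \in S -> i \notin C -> val x i < n.
  move=> xS iC; have := eqP (valP x); rewrite (bigD1 i) //= => xm.
  apply: (arith _ 0 _ (\sum_(k in C) mu k)) (eq_leq xm); last by rewrite add0n.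
    rewrite [X in _ <= X](bigID (mem C)) /=.
    rewrite [X in _ <= X + _](eq_bigl (mem C)).
      by apply: leq_trans (leq_addr _ _); apply: leq_sum => k _; exact: mu_le.
    move=> k /=; rewrite andbC; case: (boolP (k \in C)) => //= kC.
    by apply: contraNneq iC => <-.
exists (val x0) => [|i]; first exact/eqP/(valP x0).
have [iC|iC] := boolP (i \in C); last by left; rewrite ltnW // bndNC.
right; have [y yS yi] := colC i iC; exists (val y); split => //; first exact/eqP/(valP y).
have close (z w : V) k : z \in S -> w \in S -> val z k <= val w k + n.
  move=> zS wS; have [kC|kC] := boolP (k \in C).
    by apply: leq_trans (ltnW (bndC z k zS kC)) _; rewrite leq_add2r (mu_le k w).
  by apply: leq_trans (ltnW (bndNC z k zS kC)) _; exact: leq_addl.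
by move=> k; split; exact: close.
Qed.

Require Import Defs.
From mathcomp Require Import all_order all_algebra finmap.
From mathcomp Require Import all_classical all_reals all_analysis.
From mathcomp Require Import ring lra.

Import Order.TTheory GRing.Theory Num.Theory.
Import numFieldNormedType.Exports.

Local Open Scope classical_set_scope.
Local Open Scope ring_scope.

(** * Closed covers of the simplex *)

(** The sets [B i] form a filter base, and a cluster point of its filter is the required point. They
    need not be closed. *)
Lemma compact_directed (T : topologicalType) (I : Type) (D : set I)
    (A : set T) (B : I -> set T) :
  compact A -> D !=set0 ->
  (forall i, D i -> B i `<=` A) -> (forall i, D i -> B i !=set0) ->
  (forall i j, D i -> D j -> exists2 k, D k & B k `<=` B i `&` B j) ->
  exists2 x, A x & forall i, D i -> forall U, nbhs x U -> B i `&` U !=set0.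
Proof.
move=> cA [i0 Di0] BA B0 dir.
have FF : Filter (filter_from D B) by apply: filter_from_filter => //; exists i0.
have PF := filter_from_proper FF B0.
have [|x [Ax clx]] := cA (filter_from D B) PF; first by exists i0 => //; exact: BA.
by exists x => // i Di U xU; apply: clx => //; exists i.
Qed.

Lemma compact_decreasing (R : realType) (T : topologicalType) (A : set T)
    (B : R -> set T) :
  compact A -> (forall e, 0 < e -> B e `<=` A) ->
  (forall e, 0 < e -> B e !=set0) ->
  (forall e d, 0 < e -> e <= d -> B e `<=` B d) ->
  exists2 x, A x & forall e, 0 < e -> forall U, nbhs x U -> B e `&` U !=set0.
Proof.
move=> cA BA B0 mon.
apply: (@compact_directed _ _ [set e | 0 < e]) => //; first by exists 1 => /=.
move=> e d e0 d0; exists (Num.min e d); first by rewrite /= lt_min e0.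
have m0 : 0 < Num.min e d by rewrite lt_min e0.
by move=> x Bx; split; apply: mon Bx; rewrite // ge_min lexx ?orbT.
Qed.

Lemma rV_norm_le (R : realType) n (u : 'rV[R]_n) (e : R) :
  0 <= e -> (forall j, `|u 0 j| <= e) -> `|u| <= e.
Proof.
move=> e0 ue; rewrite [leLHS]/Num.norm /= mx_normrE; apply/bigmax_leP.
by split=> // -[i j] _ /=; rewrite ord1.
Qed.

Lemma rV_coord_le (R : realType) n (u : 'rV[R]_n) j : `|u 0 j| <= `|u|.
Proof.
rewrite [leRHS]/Num.norm /= mx_normrE.
by rewrite (le_trans _ (le_bigmax _ _ (0, j))).
Qed.

Lemma continuous_sum (R : realType) (T : topologicalType) (V : normedModType R)
    (I : Type) (s : seq I) (f : I -> T -> V) :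
  (forall i, continuous (f i)) -> continuous (fun x => \sum_(i <- s) f i x).
Proof.
move=> cf; elim: s => [|i s IH].
  by under eq_fun do rewrite big_nil; move=> x; exact: cvg_cst.
under eq_fun do rewrite big_cons.
by move=> x; apply: cvgD; [exact: cf|exact: IH].
Qed.

Definition simplex (R : realType) n : set 'rV[R]_n :=
  [set t | (forall i, 0 <= t 0 i) /\ \sum_i t 0 i = 1].

Lemma compact_simplex (R : realType) n : compact (@simplex R n).
Proof.
apply: bounded_closed_compact.
  exists 1; split => // M M1 t [t0 t1]; apply: rV_norm_le => [|j].
    by rewrite (le_trans ler01) ?ltW.
  rewrite ger0_norm // (le_trans _ (ltW M1)) // -t1 (bigD1 j) //= lerDl.
  exact: sumr_ge0.
rewrite (_ : @simplex R n = (\bigcap_i [set t : 'rV_n | 0 <= t 0 i]) `&`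
   [set t : 'rV_n | \sum_i t 0 i = 1]); last first.
  by apply/seteqP; split => t [t0 t1]; split => // i; [move=> _; exact: t0|exact: (t0 i)].
apply: closedI.
  apply: closed_bigI => i _.
  apply: (@preimage_closed _ _ (fun t : 'rV[R]_n => t 0 i) [set x | 0 <= x]).
    by move=> t _; exact: coord_continuous.
  exact: closed_ge.
apply: (@preimage_closed _ _ (fun t : 'rV[R]_n => \sum_i t 0 i) [set 1]).
  by move=> t _; apply: continuous_sum => i; exact: coord_continuous.
exact: closed_eq.
Qed.

(* dual form of the Knaster-Kuratowski-Mazurkiewicz lemma *)
Lemma simplex_cover (R : realType) n (G : 'I_n -> set 'rV[R]_n) :
  (0 < n)%N -> (forall i, closed (G i)) ->
  (forall t, simplex t -> exists i, G i t) ->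
  (forall t i, simplex t -> t 0 i = 0 -> G i t) ->
  exists2 t, simplex t & forall i, G i t.
Proof.
move=> n0 Gcl Gcov Gface.
(* Approximate solutions: the two alternatives are those of [grid_rainbow] after division by the
   mesh number [m]. *)
pose B e := [set t : 'rV[R]_n | simplex t /\ forall i, t 0 i <= e \/
  exists2 y, G i y & `|t - y| <= e].
have [|e e0|e d e0 ed|t tS tB] :=
  @compact_decreasing _ _ (@simplex R n) B (@compact_simplex R n).
- by move=> e _ t [].
- pose m := (Num.truncn (n%:R / e)).+1.
  have m0 : 0 < m%:R :> R by rewrite ltr0n.
  have nm : n%:R / m%:R <= e.
    rewrite ler_pdivrMr // mulrC -ler_pdivrMr // ltW //.
    by rewrite truncnS_gt.
  pose p (x : {ffun 'I_n -> 'I_m.+1}) : 'rV[R]_n := \row_i ((x i)%:R / m%:R).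
  have pS (x : {ffun 'I_n -> 'I_m.+1}) : (\sum_i x i = m)%N -> simplex (p x).
    move=> xm; split=> [i|]; first by rewrite mxE divr_ge0.
    under eq_bigr do rewrite mxE.
    by rewrite -mulr_suml -natr_sum xm divff ?gt_eqF.
  pose i0 := Ordinal n0.
  (* The default [i0] can occur only for grid functions whose sum is not [m], since [Gcov] provides
     a label on the simplex. *)
  pose col x := xget i0 [set i | G i (p x)].
  have [x xm xB] := grid_rainbow i0 col.
  exists (p x); split; first exact: pS.
  move=> i; have [xi|[y [ym yi xy]]] := xB i; [left|right].
    rewrite mxE (le_trans _ nm) // ler_pM2r ?invr_gt0 // ler_nat //.
  exists (p y).
    have [j Gj] := Gcov _ (pS y ym).
    by have := @xgetPex _ i0 [set i | G i (p y)] (ex_intro _ j Gj); rewrite -/(col y) yi.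
  apply: rV_norm_le => [|k]; first exact: ltW.
  rewrite !mxE -mulrBl normrM normfV (@ger0_norm _ m%:R) // (le_trans _ nm) //.
  rewrite ler_pM2r ?invr_gt0 // ler_norml.
  have [xy1 xy2] := xy k.
  have xk : (x k)%:R <= (y k)%:R + n%:R :> R by rewrite -natrD ler_nat.
  have yk : (y k)%:R <= (x k)%:R + n%:R :> R by rewrite -natrD ler_nat.
  by apply/andP; split; lra.
- move=> t [tS tB]; split => // i; have [ti|[y Gy ty]] := tB i.
    by left; exact: le_trans ed.
  by right; exists y => //; exact: le_trans ed.
exists t => // i; apply: contrapT => nGt.
have ti : 0 < t 0 i.
  rewrite lt_neqAle tS.1 andbT; apply/eqP => /esym/(Gface t i tS); exact: nGt.
have : nbhs t (~` G i) by apply: open_nbhs_nbhs; split; rewrite ?openC.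
move=> /nbhs_ballP[e /= e0 eG].
(* Within [d] of [t], a point has its coordinate [i] above [d] and lies farther than [d] from [G i];
   both alternatives of [B d] fail. *)
pose d := Num.min (e / 4) (t 0 i / 4).
have d0 : 0 < d by rewrite lt_min !divr_gt0.
have [de dt] : d <= e / 4 /\ d <= t 0 i / 4 by rewrite !ge_min !lexx orbT.
have [x [[xS xB]]] := tB d d0 _ (nbhsx_ballx t d d0).
rewrite -ball_normE /= => tx.
have [xi|[y Gy xy]] := xB i.
  have := le_lt_trans (rV_coord_le (t - x) i) tx; rewrite !mxE ltr_norml => /andP[_].
  by move=> h; lra.
apply: (eG y) => //; rewrite -ball_normE /= -(subrKA x).
by apply: le_lt_trans (ler_normD _ _) _; lra.
Qed.

(** * Kakutani's fixed point theorem *)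

Lemma convex_setP (R : realType) (E : lmodType R) (A : set E) :
  convex_set A <-> forall x y (l : R), 0 <= l -> l <= 1 -> A x -> A y ->
    A (l *: x + (1 - l) *: y).
Proof.
split=> [cA x y l l0 l1 Ax Ay|cA x y l].
  have := cA x y (@Itv01 R l l0 l1); rewrite !inE => /(_ Ax Ay).
  by rewrite /conv /=.
rewrite !inE => Ax Ay; apply: cA => //.
Qed.

(** Points of weight zero are unconstrained, because an approximate fixed point controls only the
    points of nonzero weight. *)
Lemma convex_sum (R : realType) (E : lmodType R) (A : set E) n
    (t : 'I_n -> R) (z : 'I_n -> E) :
  convex_set A -> (forall i, 0 <= t i) -> \sum_i t i = 1 ->
  (forall i, t i != 0 -> A (z i)) -> A (\sum_i t i *: z i).
Proof.
move=> /convex_setP cA t0 t1 Az.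
(* Induction invariant: a partial sum is its total weight times a point [v], which lies in [A] once
   that weight is positive. *)
suff [v [Sv ->]] : exists v, (0 < \sum_i t i -> A v) /\
    \sum_i t i *: z i = (\sum_i t i) *: v.
  by rewrite t1 scale1r; apply: Sv; rewrite t1.
rewrite {t1}; elim: (index_enum _) => [|i s [v [Sv vE]]].
  by exists 0; rewrite !big_nil ltxx scale0r.
rewrite !big_cons vE; set S := \sum_(j <- s) t j in Sv *.
have S0 : 0 <= S by exact: sumr_ge0.
have [ti|ti] := eqVneq (t i) 0; first by exists v; rewrite ti scale0r !add0r.
have ti0 : 0 < t i by rewrite lt_neqAle eq_sym ti t0.
move: S0; rewrite le_eqVlt => /predU1P[<-|S0].
  by exists (z i); rewrite scale0r !addr0; split=> // _; exact: Az.
have tS0 : 0 < t i + S by rewrite addr_gt0.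
exists ((t i / (t i + S)) *: z i + (1 - t i / (t i + S)) *: v); split=> [_|].
  apply: cA; [by rewrite divr_ge0 // ltW| |exact: Az|exact: Sv].
  by rewrite ler_pdivrMr // mul1r lerDl ltW.
rewrite scalerDr !scalerA; congr (_ *: _ + _ *: _); field; exact: lt0r_neq0.
Qed.

Section Kakutani.
Variables (R : realType) (V : normedModType R) (C : set V) (F : V -> set V).
Hypotheses (C_convex : convex_set C) (C_compact : compact C).
Hypothesis C_nonempty : C !=set0.
Hypothesis F_sub : forall x, C x -> F x `<=` C.
Hypothesis F_nonempty : forall x, C x -> F x !=set0.

Lemma approximate_fixed_point (e : R) : 0 < e ->
  exists n (x' z : 'I_n -> V) (t : 'rV[R]_n),
    let x := \sum_i t 0 i *: z i in
    [/\ simplex t, C x, forall i, C (x' i) /\ F (x' i) (z i)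
      & forall i, t 0 i != 0 -> `|x' i - x| < e].
Proof.
move=> e0; have := C_compact; rewrite compact_cover => cC.
have [|x Cx|D DC Dcov] := cC V C (fun x => ball x e).
- by move=> x _; exact: ball_open.
- by exists x => //; exact: ballxx.
pose n := size (enum_fset D).
pose x' (i : 'I_n) := nth 0 (enum_fset D) i.
have x'C i : C (x' i).
  by apply/set_mem/DC; rewrite mem_nth.
have net x : C x -> exists i, `|x' i - x| < e.
  move=> /Dcov[y /= yD]; rewrite -ball_normE /= => yx.
  have iD : (index y (enum_fset D) < n)%N by rewrite index_mem.
  by exists (Ordinal iD); rewrite /x' /= nth_index.
pose z i := xget 0 (F (x' i)).
have Fz i : F (x' i) (z i) by apply: xgetPex; exact: F_nonempty.
pose p (t : 'rV[R]_n) := \sum_i t 0 i *: z i.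
have pC t : simplex t -> C (p t).
  by move=> [t0 t1]; apply: convex_sum => // i _; exact: (F_sub (x'C i)).
have cp : continuous p.
  apply: continuous_sum => i t.
  apply: (@continuousZr_tmp _ _ _ (fun t : 'rV[R]_n => t 0 i)).
  exact: coord_continuous.
pose g i t := Num.max 0 (e - `|x' i - p t|).
have cg i : continuous (g i).
  have ch : continuous (fun t => e - `|x' i - p t|).
    move=> t; apply: (@continuousB _ _ _ (fun=> e) (fun t => `|x' i - p t|)).
      exact: cst_continuous.
    apply: (continuous_comp _ (@norm_continuous _ _ _)).
    by apply: (@continuousB _ _ _ (fun=> x' i) p); [exact: cst_continuous|exact: cp].
  move=> t; apply: (@continuous_max _ _ (fun=> 0) _ t) (ch t).
  exact: cst_continuous.
have g0 i t : 0 <= g i t by rewrite le_max lexx.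
pose S t := \sum_i g i t.
pose G i := [set t : 'rV[R]_n | t 0 i * S t <= g i t].
have [||||t tS tG] := @simplex_cover R n G.
- have [x /net[i _]] := C_nonempty; exact: leq_ltn_trans (ltn_ord i).
- move=> i.
  rewrite (_ : G i = (fun t => g i t - t 0 i * S t) @^-1` [set r | 0 <= r]); last first.
    by apply/seteqP; split => t; rewrite /G /= subr_ge0.
  apply: preimage_closed; last exact: closed_ge.
  move=> t _; apply: (@continuousB _ _ _ (g i) (fun t => t 0 i * S t)).
    exact: cg.
  apply: (@continuousM _ _ (fun t : 'rV[R]_n => t 0 i) S).
    exact: coord_continuous.
  by apply: continuous_sum; exact: cg.
(* If [t] were in no [G i], adding the reversed strict inequalities would give [S t < S t]. *)
- move=> t [t0 t1]; apply: contrapT => /forallNP nG.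
  have : \sum_i g i t < \sum_i t 0 i * S t.
    have [x /net[i _]] := C_nonempty.
    apply: ltr_sum => [|j _]; last by rewrite ltNge; apply/negP/nG.
    by apply/hasP; exists i => //; rewrite mem_index_enum.
  by rewrite -mulr_suml t1 mul1r ltxx.
- by move=> t i _ ti; rewrite /G /= ti mul0r.
exists n, x', z, t => /=; split=> //; first exact: pC.
(* Some net point is [e]-close to [p t], so [S t] is positive; with [t 0 i] positive, membership in
   [G i] makes [g i t] positive. *)
move=> i ti; have [j jx] := net _ (pC t tS).
have S0 : 0 < S t.
  rewrite /S (bigD1 j) //= ltr_pwDl //; last by apply: sumr_ge0.
  by rewrite lt_max subr_gt0 jx orbT.
have : 0 < g i t.
  by apply: lt_le_trans (tG i); rewrite mulr_gt0 // lt_neqAle eq_sym ti tS.1.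
by rewrite lt_max ltxx subr_gt0.
Qed.

Hypothesis F_convex : forall x, C x -> convex_set (F x).
Hypothesis F_closed_graph : forall x y, C x -> C y -> ~ F x y ->
  \forall y' \near y & x' \near x, C x' -> C y' -> ~ F x' y'.

Theorem kakutani : exists2 x, C x & F x x.
Proof.
pose B (e : R) := [set x | C x /\ exists n (x' z : 'I_n -> V) (t : 'rV[R]_n),
  [/\ simplex t, forall i, C (x' i) /\ F (x' i) (z i),
      forall i, t 0 i != 0 -> `|x' i - x| < e & x = \sum_i t 0 i *: z i]].
have [|e e0|e d e0 ed|x Cx xB] := @compact_decreasing _ _ C B C_compact.
- by move=> e _ x [].
- have [n [x' [z [t [tS Cx Fz h]]]]] := approximate_fixed_point e0.
  by eexists; split; [exact: Cx|exists n, x', z, t].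
- move=> x [Cx [n [x' [z [t [tS Fz h xE]]]]]]; split=> //.
  by exists n, x', z, t; split=> // i /h /lt_le_trans; apply.
exists x => //; apply: contrapT => nF.
have [h h0 hP] : exists2 h, 0 < h & forall y, C y -> `|x - y| < 2 * h -> ~ F x y.
  have [[P Q] /= [xP xQ] PQ] := F_closed_graph Cx Cx nF.
  move: xP => /nbhs_ballP[r /= r0 rP]; exists (r / 2); rewrite ?divr_gt0 //.
  move=> y Cy xy; apply: (PQ (y, x)) => //; split; last exact: nbhs_singleton.
  by apply: rP; rewrite -ball_normE /=; lra.
(* The plan is to place an approximate fixed point near [x] inside this convex neighbourhood of
   [F x], which brings [F x] within [2 * h] of [x]. *)
pose N := [set y | exists2 u, F x u & `|y - u| < h].
have N_convex : convex_set N.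
  apply/convex_setP => y1 y2 l l0 l1 [u1 F1 yu1] [u2 F2 yu2].
  exists (l *: u1 + (1 - l) *: u2).
    by have /convex_setP := F_convex Cx; apply.
  rewrite opprD addrACA -!scalerBr (le_lt_trans (ler_normD _ _)) // !normrZ.
  rewrite !ger0_norm ?subr_ge0 //.
  have [->|l0'] := eqVneq l 0; first by rewrite mul0r add0r subr0 mul1r.
  have lp : 0 < l by rewrite lt_neqAle eq_sym l0'.
  have -> : h = l * h + (1 - l) * h by ring.
  by apply: ltr_leD; [rewrite ltr_pM2l|rewrite ler_wpM2l ?subr_ge0 // ltW].
(* A closed graph with values in the compact set [C] gives upper semicontinuity at [x]. *)
have [d d0 dP] : exists2 d, 0 < d & forall x' y, `|x - x'| < d -> C x' -> F x' y -> N y.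
  have /nbhs_ballP[d /= d0 dP] :
      \forall x' \near x, C `<=` (fun y => C x' -> F x' y -> N y).
    move/compact_near_coveringP : C_compact; apply => y Cy.
    have [Fy|nFy] := pselect (F x y).
      exists (ball y h, setT) => /=.
        by split; [exact: nbhsx_ballx|exact: filterT].
      move=> [y' x'] /= [yy' _] _ _; exists y => //.
      by rewrite distrC; move: yy'; rewrite -ball_normE.
    apply: filterS (F_closed_graph Cx Cy nFy) => -[y' x'] /= H Cx' Fy'.
    by case: (H Cx' (F_sub Cx' Fy')).
  exists d => // x' y xx' Cx' Fy; apply: (dP x') (F_sub Cx' Fy) Cx' Fy.
  by rewrite -ball_normE.
(* The bound [d / 2] puts the points [x' i] of nonzero weight within [d] of [x]; the bound [h]
   closes the final triangle inequality. *)
pose r := Num.min (d / 2) h.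
have r0 : 0 < r by rewrite lt_min divr_gt0.
have [w [[Cw [n [x' [z [t [[t0 t1] Fz near_w wE]]]]]]]] :=
  xB _ (divr_gt0 d0 (ltr0n R 2)) _ (nbhsx_ballx x r r0).
rewrite -ball_normE /= lt_min => /andP[xwd xwh].
have [u Fu wu] : N w.
  rewrite wE; apply: convex_sum => // i ti.
  apply: (dP (x' i)); [|exact: (Fz i).1|exact: (Fz i).2].
  rewrite -(subrKA w) (le_lt_trans (ler_normD _ _)) //.
  by have := near_w i ti; rewrite distrC; lra.
apply: (hP u); [exact: F_sub Fu| |exact: Fu].
by rewrite -(subrKA w) (le_lt_trans (ler_normD _ _)) //; lra.
Qed.

End Kakutani.

(** * Best responses and projections *)

Lemma prod_topology_continuous (T : topologicalType) (I : eqType)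
    (Y : I -> topologicalType) (f : T -> prod_topology Y) :
  (forall i, continuous (fun t => f t i)) -> continuous f.
Proof.
move=> cf t; apply/cvg_sup => i U [_ [[B oB <-] Bft] BU].
by apply: filterS BU _; apply: cf; apply: open_nbhs_nbhs.
Qed.

Lemma dfwith_continuous2 (I : eqType) (Y : I -> topologicalType) (i : I) :
  continuous (fun p : prod_topology Y * Y i => dfwith p.1 i p.2 : prod_topology Y).
Proof.
apply: prod_topology_continuous => j; have [ij|ij] := eqVneq i j.
  subst j; under eq_fun do rewrite dfwithin; move=> p; exact: cvg_snd.
under eq_fun do rewrite dfwithout //.
have cj : continuous (fun x : prod_topology Y => x j) by exact: proj_continuous.
by move=> p; exact: (cvg_comp _ _ (cvg_fst (F := nbhs p.1) (G := nbhs p.2)) (cj p.1)).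
Qed.

Lemma near_comp2 (S T S' T' : topologicalType) (f : S -> S') (g : T -> T')
    (P : S' -> T' -> Prop) s t :
  {for s, continuous f} -> {for t, continuous g} ->
  (\forall s' \near f s & t' \near g t, P s' t') ->
  \forall s' \near s & t' \near t, P (f s') (g t').
Proof.
move=> cf cg [[U V] /= [fU gV] UV]; exists (f @^-1` U, g @^-1` V) => /=.
  by split; [exact: cf|exact: cg].
by move=> [s' t'] /= [Us Vt]; exact: (UV (f s', g t')).
Qed.

Lemma upper_pseudo_continuous_comp (R : realType) (S T : topologicalType)
    (g : S -> T) (f : T -> R) :
  continuous g -> upper_pseudo_continuous f -> upper_pseudo_continuous (f \o g).
Proof. by move=> cg uf x y /uf; exact: cg. Qed.

(** The sublevel sets at attained levels are directed. At a cluster point [x] with [f y < f x],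
    lower pseudo-continuity would keep a whole neighbourhood of [x] out of the sublevel set of
    [y]. *)
Lemma lower_pseudo_continuous_argmin (R : realType) (T : topologicalType)
    (A : set T) (f : T -> R) :
  compact A -> A !=set0 -> lower_pseudo_continuous f ->
  exists2 x, A x & forall y, A y -> f x <= f y.
Proof.
move=> cA A0 lf.
have [|||x Ax xA] :=
  @compact_directed _ _ A A (fun y => [set x | A x /\ f x <= f y]) cA A0.
- by move=> y _ x [].
- by move=> y Ay; exists y.
- move=> y z Ay Az; case: (leP (f y) (f z)) => yz.
    by exists y => // x [Ax xy]; split; split=> //; exact: le_trans yz.
  by exists z => // x [Ax xz]; split; split=> //; exact: le_trans (ltW yz).
- exists x => // y Ay; rewrite leNgt; apply/negP => yx.
  have [|z [[_ zy]]] := xA y Ay [set z | - f z < - f y].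
    by apply: lf; rewrite ltrN2.
  by rewrite /= ltrN2 ltNge zy.
Qed.

(* If no value of [f] lies strictly between [f p] and [f q], then
   [f p' < f q] means [f p' <= f p] and [f q' > f p] means [f q' >= f q]. *)
Lemma pseudo_continuous_lt (R : realType) (T : topologicalType) (f : T -> R) p q :
  pseudo_continuous f -> f p < f q ->
  \forall p' \near p & q' \near q, f p' < f q'.
Proof.
move=> [uf lf] pq.
have [[s [ps sq]]|nos] := pselect (exists s, f p < f s /\ f s < f q).
  exists ([set p' | f p' < f s], [set q' | - f q' < - f s]) => /=.
    by split; [exact: uf|apply: lf; rewrite ltrN2].
  by move=> [p' q'] /= []; rewrite ltrN2; exact: lt_trans.
exists ([set p' | f p' < f q], [set q' | - f q' < - f p]) => /=.
  by split; [exact: uf|apply: lf; rewrite ltrN2].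
move=> [p' q'] /= []; rewrite ltrN2 => p'q pq'.
rewrite ltNge; apply/negP => q'p'; apply: nos.
by exists p'; split=> //; exact: lt_le_trans q'p'.
Qed.

(** * Lipschitz maps and seminorms *)

Lemma lipschitz_bound_continuous (R : realType) (U V : normedModType R)
    (f : U -> V) (L : R) :
  0 <= L -> (forall u v, `|f u - f v| <= `|u - v| * L) -> continuous f.
Proof.
move=> L0 fL u; apply/cvgrPdist_lt => e e0.
near=> v; apply: le_lt_trans (fL u v) _.
(* Passing to [L + 1] allows the division when [L] is zero. *)
apply: (@le_lt_trans _ _ (`|u - v| * (L + 1))); first by rewrite ler_wpM2l // lerDl.
rewrite -ltr_pdivlMr ?ltr_wpDl //.
near: v; apply: (@cvgr_dist_lt _ _ _ (nbhs u) _ id u); first exact: cvg_id.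
by rewrite divr_gt0 // ltr_wpDl.
Unshelve. all: by end_near. Qed.

Lemma dist_continuous (R : realType) (V : normedModType R) (w : V) :
  continuous (fun v => `|w - v|).
Proof.
apply: (@lipschitz_bound_continuous _ _ R^o _ 1) => // u v.
rewrite mulr1 (le_trans (ler_dist_dist _ _)) //.
by rewrite opprB addrC addrA subrK distrC.
Qed.

(** Expansion in the standard basis bounds [q] by a multiple of the sup norm, and the reverse
    triangle inequality makes [q] Lipschitz. This is how an arbitrary norm is handled. *)
Lemma seminorm_continuous (R : realType) d (q : 'rV[R]_d -> R) :
  (forall u v, q (u + v) <= q u + q v) -> (forall a u, q (a *: u) = `|a| * q u) ->
  continuous q.
Proof.
move=> qD qZ.
have qN u : q (- u) = q u by rewrite -scaleN1r qZ normrN1 mul1r.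
have q0 : q 0 = 0 by rewrite -(scale0r 0) qZ normr0 mul0r.
have q_ge0 u : 0 <= q u.
  by have := qD u (- u); rewrite subrr q0 qN; lra.
pose L := \sum_j q (delta_mx 0 j).
have qL u : q u <= `|u| * L.
  rewrite {1}[u]row_sum_delta mulr_sumr.
  elim/big_ind2 : _ => [|a b c e ab ce|j _]; rewrite ?q0 //.
    by apply: le_trans (qD _ _) _; exact: lerD.
  by rewrite qZ ler_wpM2r // rV_coord_le.
have L0 : 0 <= L by exact: sumr_ge0.
apply: (@lipschitz_bound_continuous _ _ R^o _ _ L0) => u v.
apply: le_trans (qL _); rewrite ler_norml; apply/andP; split.
  by have := qD (v - u) u; rewrite subrK -[q (v - u)]qN opprB; lra.
by have := qD (u - v) v; rewrite subrK; lra.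
Qed.

(** * Coordinates on the product of the strategy spaces *)

Section Flattening.
Variables (R : realType) (N : finType) (n : N -> nat).
Let J := {nu : N & 'I_(n nu)}.
Let J_ := fun nu : N => 'I_(n nu).

(** All coordinates of all players are listed in one row vector. This gives a normed space in which
    Kakutani's theorem applies, with a continuous linear surjection onto the product. *)
Definition unflatten (w : 'rV[R]_#|{: J}|) : player_space R n :=
  fun nu => \row_j w 0 (enum_rank (Tagged J_ j)).

Lemma unflattenD u v : unflatten (u + v) = fun nu => unflatten u nu + unflatten v nu.
Proof. by apply: functional_extensionality_dep => nu; apply/rowP => j; rewrite !mxE. Qed.

Lemma unflattenZ a u : unflatten (a *: u) = fun nu => a *: unflatten u nu.
Proof. by apply: functional_extensionality_dep => nu; apply/rowP => j; rewrite !mxE. Qed.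

Lemma unflattenB u v : unflatten (u - v) = fun nu => unflatten u nu - unflatten v nu.
Proof. by apply: functional_extensionality_dep => nu; apply/rowP => j; rewrite !mxE. Qed.

Lemma unflatten_surj x : exists w, unflatten w = x.
Proof.
exists (\row_k x (tag (enum_val k)) 0 (tagged (enum_val k))).
apply: functional_extensionality_dep => nu; apply/rowP => j.
by rewrite !mxE enum_rankK.
Qed.

Lemma norm_unflatten w (M : R) :
  0 <= M -> (forall nu, `|unflatten w nu| <= M) -> `|w| <= M.
Proof.
move=> M0 wM; apply: rV_norm_le => // k.
have := le_trans (rV_coord_le _ (tagged (enum_val k))) (wM (tag (enum_val k))).
rewrite mxE (_ : Tagged J_ _ = enum_val k) ?enum_valK //.
by case: (enum_val k).
Qed.

Lemma unflatten_coord_continuous nu : continuous (fun w => unflatten w nu).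
Proof.
apply: (@lipschitz_bound_continuous _ _ _ _ 1) => // u v.
have := congr1 (fun f => f nu) (unflattenB u v) => /= <-; rewrite mulr1.
by apply: rV_norm_le => // j; rewrite mxE rV_coord_le.
Qed.

Lemma unflatten_continuous : continuous unflatten.
Proof. by apply: prod_topology_continuous => nu; exact: unflatten_coord_continuous. Qed.

End Flattening.

(** * Constraint maps and best responses *)

Lemma near_subspace (S : topologicalType) (A P : set S) (x : S) :
  A x -> (\forall x' \near (x : subspace A), P x') ->
  \forall x' \near x, A x' -> P x'.
Proof.
by move=> Ax h; have : within A (nbhs x) P by rewrite (nbhs_subspace_in Ax).
Qed.

(** Near each point the values stay in a ball slightly larger than one containing the compact value
    there; compactness of [A] makes the bound uniform. *)
Lemma usc_bounded (R : realType) (S : topologicalType) (V : normedModType R)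
    (A : set S) (T : S -> set V) :
  compact A -> (forall x, A x -> compact (T x)) ->
  (forall x, A x -> usc_map_at (T : subspace A -> set V) x) ->
  \forall M \near +oo, forall x, A x -> forall v, T x v -> `|v| <= M.
Proof.
move=> cA cT uT.
(* The premise [A x] is repeated inside the predicate because the covering argument uses
   neighbourhoods that may leave [A]. *)
have : \forall M \near +oo, A `<=` (fun x => A x -> forall v, T x v -> `|v| <= M).
  move/compact_near_coveringP : cA; apply => x Ax.
  have [M0 [_ TM]] := compact_bounded (cT x Ax).
  pose r := M0 + 1.
  have : \forall x' \near (x : subspace A), T x' `<=` [set v | `|v| < r + 1].
    apply: uT => //.
      apply: (@open_comp _ _ (fun v : V => `|v|) [set s | s < r + 1]).
        by move=> v _; exact: norm_continuous.
      exact: open_lt.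
    by move=> v /TM h /=; apply: le_lt_trans (h r _) _; rewrite /r; lra.
  move=> /(near_subspace Ax) near_x.
  exists ([set x' | A x' -> T x' `<=` [set v | `|v| < r + 1]], [set M | r + 1 < M]) => /=.
    by split; [exact: near_x|exact: (nbhs_pinfty_gt (num_real _))].
  by move=> [x' M] /= [Tx' rM] Ax' v /(Tx' Ax') /= vr; exact: ltW (lt_trans vr rM).
by move=> /filterS; apply => M AM x Ax; exact: (AM x Ax Ax).
Qed.

Section BestResponse.
Variables (R : realType) (N : finType) (n : N -> nat).
Variables (A : set (player_space R n)) (nu : N).
Variables (X : player_space R n -> set 'rV[R]_(n nu)) (theta : player_space R n -> R).

(** The constraint set comes from [x], the strategies of the other players from [y]; a projected
    solution keeps these two points apart. *)
Definition best_response (x y : player_space R n) : set 'rV[R]_(n nu) :=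
  [set w | X x w /\
    forall u, X x u -> theta (dfwith y nu w) <= theta (dfwith y nu u)].

Hypothesis theta_pc : pseudo_continuous theta.

Lemma best_response_nonempty x y :
  compact (X x) -> X x !=set0 -> best_response x y !=set0.
Proof.
move=> cX X0.
have [|w Xw wmin] := @lower_pseudo_continuous_argmin R _ (X x)
  (fun w => theta (dfwith y nu w)) cX X0.
  apply: (@upper_pseudo_continuous_comp R _ (player_space R n) (dfwith y nu)
    (fun z => - theta z) _ theta_pc.2).
  exact: (@dfwith_continuous N (fun nu => 'rV[R]_(n nu))).
by exists w.
Qed.

Lemma best_response_convex x y :
  convex_set (X x) -> quasi_convex (fun w : 'rV[R]_(n nu) => theta (dfwith y nu w)) ->
  convex_set (best_response x y).
Proof.
move=> cX qth w1 w2 l; rewrite !inE => -[X1 m1] [X2 m2]; split.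
  by apply/set_mem; apply: cX; rewrite inE.
move=> u Xu; apply: le_trans (qth l w1 w2) _.
by rewrite ge_max m1 // m2.
Qed.

(** There are two ways to fail. If [w] is infeasible, upper semicontinuity keeps the values of [X]
    away from [w]. If some feasible [u] is strictly better, lower semicontinuity supplies feasible
    points near [u], and [pseudo_continuous_lt] preserves the strict inequality. *)
Lemma best_response_closed x y w :
  A x -> compact (X x) ->
  lsc_map_at (X : subspace A -> set 'rV[R]_(n nu)) x ->
  usc_map_at (X : subspace A -> set 'rV[R]_(n nu)) x ->
  ~ best_response x y w ->
  \forall w' \near w & p \near (x, y), A p.1 -> ~ best_response p.1 p.2 w'.
Proof.
move=> Ax cX lX uX nB.
have [Xw|nXw] := pselect (X x w); last first.
  have : nbhs w (~` X x).
    apply: open_nbhs_nbhs; split=> //; rewrite openC.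
    by apply: compact_closed cX; exact: norm_hausdorff.
  move=> /nbhs_ballP[e /= e0 eX].
  have : \forall x' \near (x : subspace A), X x' `<=` [set v | e / 2 < `|w - v|].
    apply: uX.
      apply: (@open_comp _ R (fun v : 'rV[R]_(n nu) => `|w - v|) [set s | e / 2 < s]).
        by move=> v _; exact: dist_continuous.
      exact: open_gt.
    move=> v Xv /=; rewrite ltNge; apply/negP => wv; apply: (eX v) => //.
    by rewrite -ball_normE /=; lra.
  move=> /(near_subspace Ax) near_x.
  exists (ball w (e / 2), [set p | A p.1 -> X p.1 `<=` [set v | e / 2 < `|w - v|]]) => /=.
    split; first by apply: nbhsx_ballx; rewrite divr_gt0.
    exact: (cvg_fst near_x).
  move=> [w' p] /= [ww' Xp] Ap [/(Xp Ap) /= ww'2 _].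
  by move: ww'; rewrite -ball_normE /= => /(lt_trans ww'2); rewrite ltxx.
have [u Xu uw] : exists2 u, X x u & theta (dfwith y nu u) < theta (dfwith y nu w).
  apply: contrapT => h; apply: nB; split=> // u Xu; rewrite leNgt; apply/negP => uw.
  by apply: h; exists u.
have [[U Q] /= [nU nQ] UQ] := pseudo_continuous_lt theta_pc uw.
have [[Y1 U1] /= [nY1 nU1] YU] :=
  @dfwith_continuous2 N (fun nu => 'rV[R]_(n nu)) nu (y, u) _ nU.
have [[Y2 W2] /= [nY2 nW2] YW] :=
  @dfwith_continuous2 N (fun nu => 'rV[R]_(n nu)) nu (y, w) _ nQ.
have : \forall x' \near (x : subspace A), X x' `&` U1^° !=set0.
  by apply: lX; [exact: open_interior|exists u].
move=> /(near_subspace Ax) near_x.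
exists (W2, [set p | (A p.1 -> X p.1 `&` U1^° !=set0) /\ (Y1 p.2 /\ Y2 p.2)]) => /=.
  split=> //; apply: filterI; first exact: (cvg_fst near_x).
  by apply: filterI; [exact: (cvg_snd nY1)|exact: (cvg_snd nY2)].
move=> [w' [x' y']] /= [Ww' [Xx' [Yy1 Yy2]]] Ax' [_ wmin].
have [u' [Xu' /interior_subset Uu']] := Xx' Ax'.
have : theta (dfwith y' nu u') < theta (dfwith y' nu w').
  by apply: (UQ (_, _)); split; [exact: (YU (y', u'))|exact: (YW (y', w'))].
by rewrite ltNge wmin.
Qed.
End BestResponse.

(** * Sets of nearest points: convexity and closed graph *)

Lemma seminorm_argmin_convex (R : realType) (E : lmodType R) (q : E -> R)
    (A : set E) (b : E) :
  (forall u v, q (u + v) <= q u + q v) -> (forall a u, q (a *: u) = `|a| * q u) ->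
  convex_set A ->
  convex_set [set a | A a /\ forall c, A c -> q (b - a) <= q (b - c)].
Proof.
move=> qD qZ /convex_setP cA; apply/convex_setP => a1 a2 l l0 l1 [A1 m1] [A2 m2].
split=> [|c Ac]; first exact: cA.
have -> : b - (l *: a1 + (1 - l) *: a2) = l *: (b - a1) + (1 - l) *: (b - a2).
  by rewrite !scalerBr addrACA -scalerDl subrKC scale1r opprD.
apply: le_trans (qD _ _) _; rewrite !qZ !ger0_norm ?subr_ge0 //.
have -> : q (b - c) = l * q (b - c) + (1 - l) * q (b - c) by ring.
by apply: lerD; rewrite ler_wpM2l ?subr_ge0 ?m1 ?m2.
Qed.

Lemma pair_map_continuous (S T : topologicalType) (f : S -> T) :
  continuous f -> continuous (fun u : S * S => (f u.1, f u.2)).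
Proof.
move=> cf [a b] U [[V V'] /= [aV bV'] VU].
exists (f @^-1` V, f @^-1` V') => /=; first by split; exact: cf.
by move=> [a' b'] /= [Va Vb]; exact: (VU (f a', f b')).
Qed.

(** A competitor [c] that beats [a] still beats nearby points for nearby targets; this gives the
    projection its closed graph. *)
Lemma near_dist_lt (R : realType) (V : normedModType R) (q : V -> R) (a b c : V) :
  continuous q -> q (b - c) < q (b - a) ->
  \forall a' \near a & b' \near b, q (b' - c) < q (b' - a').
Proof.
move=> q_c lt_ca; pose gap (u : V * V) := q (u.2 - u.1) - q (u.2 - c).
have c2 : continuous (fun u : V * V => u.2) by move=> u; exact: cvg_snd.
have c21 : continuous (fun u : V * V => u.2 - u.1).
  by move=> u; apply: cvgB; [exact: cvg_snd|exact: cvg_fst].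
have c2c : continuous (fun u : V * V => u.2 - c).
  by move=> u; apply: cvgB; [exact: cvg_snd|exact: cvg_cst].
have gap_c : continuous gap.
  move=> u; apply: (@continuousB _ R^o _ (fun u : V * V => q (u.2 - u.1))
    (fun u : V * V => q (u.2 - c))).
    exact: (@continuous_comp _ _ _ (fun u : V * V => u.2 - u.1) q u (c21 u) (q_c _)).
  exact: (@continuous_comp _ _ _ (fun u : V * V => u.2 - c) q u (c2c u) (q_c _)).
have [[U U'] nU gapU] : nbhs ((a, b) : V * V) (gap @^-1` [set r | 0 < r]).
  apply: gap_c; apply: open_nbhs_nbhs; split; first exact: open_gt.
  by rewrite /= subr_gt0.
by exists (U, U') => // u /gapU /=; rewrite subr_gt0.
Qed.

(** * Existence of a projected solution *)

Theorem theorem3p2 (R : realType) (N : finType) (n : N -> nat)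
    (K : forall nu : N, set 'rV[R]_(n nu))
    (X : forall nu : N, player_space R n -> set 'rV[R]_(n nu))
    (theta : N -> player_space R n -> R)
    (nrm : player_space R n -> R)
    (N_nonempty : (0 < #|N|)%N)
    (nrm_norm : is_norm nrm)
    (K_convex : forall nu, convex_set (K nu))
    (K_compact : forall nu, compact (K nu))
    (K_nonempty : forall nu, K nu !=set0)
    (X_continuous : forall nu, continuous_map_on (set_prod K) (X nu))
    (X_convex : forall nu x, set_prod K x -> convex_set (X nu x))
    (X_compact : forall nu x, set_prod K x -> compact (X nu x))
    (X_nonempty : forall nu x, set_prod K x -> X nu x !=set0)
    (theta_pseudo_continuous : forall nu, pseudo_continuous (theta nu))
    (theta_quasi_convex : forall nu (x : player_space R n),
      quasi_convex (fun w : 'rV[R]_(n nu) => theta nu (dfwith x nu w))) :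
  exists x y : player_space R n,
    [/\ set_prod K x,
        set_prod (fun nu => X nu x) y,
        metric_projection nrm (set_prod K) y x
      & forall nu (w : 'rV[R]_(n nu)), X nu x w ->
          theta nu y <= theta nu (dfwith y nu w)].
Proof.
set A := set_prod K in X_continuous X_convex X_compact X_nonempty *.
have A_compact : compact A by exact: tychonoff K_compact.
(* One radius serves for the strategy sets and for all values of the constraint maps. *)
have [M [M0 [XM KM]]] : exists M : R, 0 <= M /\
    (forall nu x, A x -> forall v, X nu x v -> `|v| <= M) /\
    (forall nu v, K nu v -> `|v| <= M).
  have XM : \forall M \near +oo,
      forall nu x, A x -> forall v, X nu x v -> `|v| <= M.
    apply: filter_forall => nu; apply: usc_bounded => // x Ax; first exact: X_compact.
    by have [] := X_continuous nu x Ax.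
  have KM : \forall M \near +oo, forall nu, forall v, K nu v -> `|v| <= M.
    by apply: filter_forall => nu; exact: compact_bounded (K_compact nu).
  have M0 : \forall M \near +oo, 0 <= M :> R by exact: nbhs_pinfty_ge.
  by have [M [? [? ?]]] := filter_ex (filterI M0 (filterI XM KM)); exists M.
pose W := 'rV[R]_#|{: {nu : N & 'I_(n nu)}}|.
pose fl : W -> player_space R n := @unflatten R N n.
have fl_conv (l : R) (u v : W) nu :
    fl (l *: u + (1 - l) *: v) nu = l *: fl u nu + (1 - l) *: fl v nu.
  by rewrite /fl unflattenD !unflattenZ.
have fl_c : continuous fl by exact: unflatten_continuous.
pose q w := nrm (fl w).
have [nrmD nrmZ _] := nrm_norm.
have qD u v : q (u + v) <= q u + q v by rewrite /q /fl unflattenD.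
have qZ a u : q (a *: u) = `|a| * q u by rewrite /q /fl unflattenZ.
have q_c : continuous q by exact: seminorm_continuous.
have q_dist_c (b : W) : continuous (fun a : W => q (b - a)).
  move=> a; apply: (@continuous_comp _ _ _ (fun a : W => b - a) q); last exact: q_c.
  apply: (@continuousB _ _ _ (fun=> b) (id : W -> W)).
    exact: cst_continuous.
  by move=> ?; exact: cvg_id.
pose CA := [set a | A (fl a)].
(* The product of the sets [X nu x] varies with [x]; the box is a fixed convex compact set
   containing all of them. *)
pose CB := [set b | forall nu, `|fl b nu| <= M].
have CA_compact : compact CA.
  apply: bounded_closed_compact.
    exists M; split; first exact: num_real.
    move=> M' MM' a Aa; apply: norm_unflatten; first exact: le_trans (ltW MM').
    by move=> nu; apply: le_trans (ltW MM'); exact: (KM nu _ (Aa nu)).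
  apply: preimage_closed => [a _|]; first exact: fl_c.
  apply: compact_closed A_compact; apply: hausdorff_product => nu.
  exact: norm_hausdorff.
have CB_compact : compact CB.
  apply: bounded_closed_compact.
    exists M; split; first exact: num_real.
    move=> M' MM' b Bb; apply: norm_unflatten; first exact: le_trans (ltW MM').
    by move=> nu; apply: le_trans (ltW MM'); exact: Bb.
  rewrite (_ : CB = \bigcap_nu [set b | `|fl b nu| <= M]); last first.
    by apply/seteqP; split => b Bb nu; [move=> _; exact: Bb|exact: (Bb nu)].
  apply: closed_bigI => nu _.
  apply: (@preimage_closed _ R (fun b => `|fl b nu|) [set s | s <= M]).
    move=> b _; apply: (@continuous_comp _ _ _ (fun b => fl b nu) (fun v => `|v|)).
      exact: unflatten_coord_continuous.
    exact: norm_continuous.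
  exact: closed_le.
have CA_convex : convex_set CA.
  apply/convex_setP => u v l l0 l1 Au Av nu; rewrite fl_conv.
  by have /convex_setP := K_convex nu; apply.
have CB_convex : convex_set CB.
  apply/convex_setP => u v l l0 l1 Bu Bv nu; rewrite fl_conv.
  apply: le_trans (ler_normD _ _) _; rewrite !normrZ !ger0_norm ?subr_ge0 //.
  have -> : M = l * M + (1 - l) * M by ring.
  by apply: lerD; rewrite ler_wpM2l ?subr_ge0 ?Bu ?Bv.
pose P b := [set a | CA a /\ forall c, CA c -> q (b - a) <= q (b - c)].
pose BR nu (z : W * W) := best_response (X nu) (theta nu) (fl z.1) (fl z.2).
pose F (z : W * W) := [set z' : W * W | P z.2 z'.1 /\ forall nu, BR nu z (fl z'.2 nu)].
have [a0 Aa0] : CA !=set0.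
  have [a aE] := unflatten_surj (fun nu => xget 0 (K nu) : 'rV[R]_(n nu)).
  exists a; rewrite /CA /= /fl aE => nu; apply: xgetPex; exact: K_nonempty.
have [|||||||z [Cz1 Cz2] [[_ zP] zBR]] := @kakutani R (W * W)%type (CA `*` CB) F.
- apply/convex_setP => u v l l0 l1 [Au Bu] [Av Bv]; split.
    by have /convex_setP := CA_convex; apply.
  by have /convex_setP := CB_convex; apply.
- exact: compact_setX.
- exists (a0, 0); split=> //= nu; rewrite (_ : fl 0 nu = 0) ?normr0 //.
  by apply/rowP => j; rewrite !mxE.
- move=> z [Az _] z' [[Az' _] Bz']; split=> // nu.
  by apply: (XM nu _ Az); case: (Bz' nu).
- move=> z [Az _].
  have [||a Aa amin] := @lower_pseudo_continuous_argmin R _ CA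
    (fun a => q (z.2 - a)) CA_compact.
  + by exists a0.
  + move=> a b ab; have ac : continuous (fun a => - q (z.2 - a)).
      by move=> c; apply: (@continuousN _ R^o _ (fun a => q (z.2 - a))); exact: q_dist_c.
    have /(ac a) : nbhs (- q (z.2 - a)) [set r | r < - q (z.2 - b)].
      by apply: open_nbhs_nbhs; split; [exact: open_lt|exact: ab].
    exact.
  have exBR nu : BR nu z !=set0.
    by apply: best_response_nonempty => //; [exact: X_compact|exact: X_nonempty].
  have [b bE] := unflatten_surj (fun nu => sval (cid (exBR nu)) : 'rV[R]_(n nu)).
  by exists (a, b); split=> [|nu]; rewrite //= /fl bE; exact: svalP.
- move=> z [Az _]; apply/convex_setP => u v l l0 l1 [Pu Bu] [Pv Bv]; split.
    by have /convex_setP := seminorm_argmin_convex (b := z.2) qD qZ CA_convex; apply.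
  move=> nu /=; rewrite fl_conv.
  have /convex_setP : convex_set (BR nu z).
    by apply: best_response_convex => //; exact: X_convex.
  by apply.
- move=> z z' [Az _] [Az' _] nF.
  (* Off the graph, the projection condition or one player's best response fails, and either failure
     persists nearby within the domain. *)
  have [Pz|nPz] := pselect (P z.2 z'.1); last first.
    have [c Ac cz] : exists2 c, CA c & q (z.2 - c) < q (z.2 - z'.1).
      apply: contrapT => h; apply: nPz; split=> // c Ac; rewrite leNgt; apply/negP => cz.
      by apply: h; exists c.
    have : \forall a \near z'.1 & b \near z.2, q (b - c) < q (b - a).
      exact: near_dist_lt.
    move=> /(near_comp2 (s := z') (t := z) (f := fst) (g := snd)).
    case=> [||[U V] UV h]; [exact: cvg_fst|exact: cvg_snd|].
    exists (U, V) => // -[u' u] /h /= uc _ _ [[_ /(_ c Ac)]].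
    by rewrite leNgt uc.
  have [nu nBR] : exists nu, ~ BR nu z (fl z'.2 nu).
    by apply/existsNP => h; apply: nF.
  have [lX uX] := X_continuous nu _ Az.
  have :=
    best_response_closed (theta_pseudo_continuous nu) Az (X_compact nu _ Az) lX uX nBR.
  move=> /(near_comp2 (s := z') (t := z) (f := fun u : W * W => fl u.2 nu)
    (g := fun u : W * W => (fl u.1, fl u.2))).
  case=> [||[U V] UV h].
  + apply: (@continuous_comp _ _ _ snd (fun b => fl b nu)); first exact: cvg_snd.
    exact: unflatten_coord_continuous.
  + exact: pair_map_continuous.
  + by exists (U, V) => // -[u' u] /h /= uc [Au _] _ [_ /(_ nu)]; exact: uc.
exists (fl z.1), (fl z.2); split=> //.
- by move=> nu; case: (zBR nu).
- split=> // x Ax; have [c cx] := unflatten_surj x; subst x.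
  by have := zP c Ax; rewrite /q /fl !unflattenB.
- move=> nu w Xw; have [_ /(_ w Xw)] := zBR nu.
  (* At the fixed point the minimiser is the own component of [fl z.2], so substituting it changes
     nothing. *)
  suff -> : dfwith (fl z.2) nu (fl z.2 nu) = fl z.2 by [].
  by apply: functional_extensionality_dep => mu; case: dfwithP.
Qed.
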